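(* Let $M,N$ be positive integers with $M$ even, let $\varepsilon=1/(2M)$, and let $y$ be the solution of the quasicontinuum system (QC) with Dirichlet boundary conditions (BC) (both written out in the context). With the notation $\alpha_k,\gamma_k,\delta_k,\rho_k,F_m,f_m$ and $P_k,p_k,R_k,r_k$ of the context, for $m=-M,\dots,-1$ and $n=-N,\dots,N$, \[ y(m,n)=-\frac{2\varepsilon}{N}\sum_{\substack{k=1\\ k\ \mathrm{odd}}}^{2N-1}\frac{\mathcal Q_k}{P_kr_k-R_kp_k}\,\frac{\sinh[(M+m)\alpha_k]}{\sinh[(M-1)\alpha_k]}\,\rho_k\cot\frac{k\pi}{4N}\,\sin\left[\frac{k\pi}{2N}(n+N)\right], \] and for $m=0,\dots,M$ and $n=-N,\dots,N$, \[ y(m,n)=-\frac{2\varepsilon}{N}\sum_{\substack{k=1\\ k\ \mathrm{odd}}}^{2N-1}\frac{\mathcal Q_{m,k}}{P_kr_k-R_kp_k}\cot\frac{k\pi}{4N}\,\sin\left[\frac{k\pi}{2N}(n+N)\right], \] where, with all $F_j,f_j$ evaluated at $(\gamma_k,\delta_k)$, \[ \begin{aligned} P_kr_k-R_kp_k&=6(8\rho_k-1)\begin{vmatrix}F_0&-F_{-1}\\ f_0&f_{-1}\end{vmatrix}+(25\rho_k-3)\begin{vmatrix}-F_1&F_0\\ f_1&f_0\end{vmatrix}-\begin{vmatrix}-F_1&F_{-2}\\ f_1&f_{-2}\end{vmatrix}\\ &\quad+(2-\rho_k)\begin{vmatrix}-F_{-1}&F_{-2}\\ f_{-1}&f_{-2}\end{vmatrix}+(5\rho_k-1)\begin{vmatrix}-F_1&-F_{-1}\\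 f_1&f_{-1}\end{vmatrix}-5\rho_k\begin{vmatrix}F_0&F_{-2}\\ f_0&f_{-2}\end{vmatrix}, \end{aligned} \] \[ \mathcal Q_k=12\begin{vmatrix}F_0&-F_{-1}\\ f_0&f_{-1}\end{vmatrix}+5\begin{vmatrix}F_0&F_{-2}+F_1\\ f_0&f_{-2}-f_1\end{vmatrix}+\begin{vmatrix}-F_{-1}&F_{-2}+F_1\\ f_{-1}&f_{-2}-f_1\end{vmatrix}, \] \[ \mathcal Q_{m,k}=3(1-10\rho_k)\begin{vmatrix}(-1)^mF_m&F_0\\ f_m&f_0\end{vmatrix}+3(1-2\rho_k)\begin{vmatrix}(-1)^mF_m&-F_{-1}\\ f_m&f_{-1}\end{vmatrix}+\begin{vmatrix}(-1)^mF_m&F_{-2}+F_1\\ f_m&f_{-2}-f_1\end{vmatrix}. \]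
   Context: $M,N$ are positive integers, $M$ even, and $\varepsilon=1/(2M)$ is the equilibrium bond length. The unknown is a real function $y(m,n)$ on the lattice points $-M\le m\le M+1$, $-N\le n\le N$. System (QC), imposed for all $n=-N+1,\dots,N-1$: (continuum region) for $m=-M+1,\dots,-2$: $12y(m,n)-y(m,n-1)-y(m,n+1)-5y(m-1,n)-5y(m+1,n)=0$; (atomistic region) for $m=2,\dots,M-1$: $6y(m,n)-y(m,n-1)-y(m,n+1)-y(m-1,n)-y(m+1,n)-y(m-2,n)-y(m+2,n)=0$; (layer $m=-1$) $\tfrac{25}{2}y(-1,n)-y(-1,n-1)-y(-1,n+1)-5y(-2,n)-5y(0,n)-\tfrac12 y(1,n)=-\varepsilon$; (layer $m=0$) $9y(0,n)-y(0,n-1)-y(0,n+1)-5y(-1,n)-y(1,n)-y(2,n)=2\varepsilon$; (layer $m=1$) $\tfrac{11}{2}y(1,n)-y(1,n-1)-y(1,n+1)-y(0,n)-y(2,n)-\tfrac12 y(-1,n)-y(3,n)=-\varepsilon$. Boundary conditions (BC): $y(-M,n)=y(M,n)=y(M+1,n)=0$ for $n=-N,\dots,N$, and $y(m,-N)=y(m,N)=0$ for $m=-M,\dots,M$. Notation, for $1\le k\le 2N-1$: $\lambda_k=2\sin^2\frac{k\pi}{4N}$, and $\alpha_k,\gamma_k,\delta_k>0$ are defined by \[ \cosh\alpha_k=1+\frac{\lambda_k}{5},\qquad \cosh\gamma_k=\frac{1+\sqrt{25+8\lambda_k}}{4},\qquad \cosh\delta_k=\frac{-1+\sqrt{25+8\lambda_k}}{4}.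 \] For every integer $m$ (including negative $m$), \[ F_m(\gamma,\delta)=\frac{\sinh[(M+1-m)\gamma]+\sinh[(M-m)\gamma]\cosh\delta-(-1)^m\cosh[(M-m)\delta]\sinh\gamma}{\cosh\gamma+\cosh\delta},\qquad f_m(\gamma,\delta)=F_m(\delta,\gamma). \] Further \[ \rho_k=\frac{\sinh[(M-1)\alpha_k]}{5\sinh[M\alpha_k]+\sinh[(M-1)\alpha_k]}, \] and, with all $F_j,f_j$ evaluated at $(\gamma_k,\delta_k)$, \[ P_k=-2F_{-1}+F_1-\rho_k(-F_{-1}+5F_0),\quad p_k=2f_{-1}-f_1-\rho_k(f_{-1}+5f_0), \] \[ R_k=3F_0+9F_{-1}+F_{-2}-5F_1,\quad r_k=3f_0-9f_{-1}+f_{-2}+5f_1. \] *)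

(* Defs.v *)
From Stdlib Require Import Reals ZArith Arith.

Open Scope R_scope.

(* Lattice functions are total functions Z -> Z -> R; the system and the boundary
   conditions only constrain their values at the lattice points
   -M <= m <= M+1, -N <= n <= N. *)

Definition bond_length (M : nat) : R := 1 / (2 * INR M).

Record QC_system (M N : nat) (y : Z -> Z -> R) : Prop := {
  QC_continuum : forall m n : Z,
    (- Z.of_nat M + 1 <= m <= -2)%Z ->
    (- Z.of_nat N + 1 <= n <= Z.of_nat N - 1)%Z ->
    12 * y m n - y m (n - 1)%Z - y m (n + 1)%Z
      - 5 * y (m - 1)%Z n - 5 * y (m + 1)%Z n = 0;
  QC_atomistic : forall m n : Z,
    (2 <= m <= Z.of_nat M - 1)%Z ->
    (- Z.of_nat N + 1 <= n <= Z.of_nat N - 1)%Z ->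
    6 * y m n - y m (n - 1)%Z - y m (n + 1)%Z
      - y (m - 1)%Z n - y (m + 1)%Z n
      - y (m - 2)%Z n - y (m + 2)%Z n = 0;
  QC_layer_m1 : forall n : Z,
    (- Z.of_nat N + 1 <= n <= Z.of_nat N - 1)%Z ->
    25 / 2 * y (-1)%Z n - y (-1)%Z (n - 1)%Z - y (-1)%Z (n + 1)%Z
      - 5 * y (-2)%Z n - 5 * y 0%Z n - 1 / 2 * y 1%Z n = - bond_length M;
  QC_layer_0 : forall n : Z,
    (- Z.of_nat N + 1 <= n <= Z.of_nat N - 1)%Z ->
    9 * y 0%Z n - y 0%Z (n - 1)%Z - y 0%Z (n + 1)%Z
      - 5 * y (-1)%Z n - y 1%Z n - y 2%Z n = 2 * bond_length M;
  QC_layer_1 : forall n : Z,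
    (- Z.of_nat N + 1 <= n <= Z.of_nat N - 1)%Z ->
    11 / 2 * y 1%Z n - y 1%Z (n - 1)%Z - y 1%Z (n + 1)%Z
      - y 0%Z n - y 2%Z n - 1 / 2 * y (-1)%Z n - y 3%Z n = - bond_length M
}.

Record boundary_conditions (M N : nat) (y : Z -> Z -> R) : Prop := {
  BC_vertical : forall n : Z, (- Z.of_nat N <= n <= Z.of_nat N)%Z ->
    y (- Z.of_nat M)%Z n = 0 /\ y (Z.of_nat M) n = 0 /\ y (Z.of_nat M + 1)%Z n = 0;
  BC_horizontal : forall m : Z, (- Z.of_nat M <= m <= Z.of_nat M)%Z ->
    y m (- Z.of_nat N)%Z = 0 /\ y m (Z.of_nat N) = 0
}.

Definition lambda (N k : nat) : R := 2 * (sin (INR k * PI / (4 * INR N)))^2.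

(* cosh is injective on the positive reals, so this pins down alpha k, gamma k and
   delta k for 1 <= k <= 2N-1; such values exist since each right-hand side exceeds 1. *)
Definition hyperbolic_parameters (N : nat) (alpha gamma delta : nat -> R) : Prop :=
  forall k : nat, (1 <= k <= 2 * N - 1)%nat ->
    (0 < alpha k /\ cosh (alpha k) = 1 + lambda N k / 5) /\
    (0 < gamma k /\ cosh (gamma k) = (1 + sqrt (25 + 8 * lambda N k)) / 4) /\
    (0 < delta k /\ cosh (delta k) = (-1 + sqrt (25 + 8 * lambda N k)) / 4).

Definition F_ (M : nat) (m : Z) (g d : R) : R :=
  (sinh (IZR (Z.of_nat M + 1 - m) * g)
   + sinh (IZR (Z.of_nat M - m) * g) * cosh d
   - powerRZ (-1) m * cosh (IZR (Z.of_nat M - m) * d) * sinh g)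
  / (cosh g + cosh d).

Definition f_ (M : nat) (m : Z) (g d : R) : R := F_ M m d g.

Definition rho (M : nat) (a : R) : R :=
  sinh (INR (M - 1) * a) / (5 * sinh (INR M * a) + sinh (INR (M - 1) * a)).

(* In the following definitions r, g, d stand for rho_k, gamma_k, delta_k. *)

Definition P_ (M : nat) (r g d : R) : R :=
  -2 * F_ M (-1) g d + F_ M 1 g d - r * (- F_ M (-1) g d + 5 * F_ M 0 g d).

Definition p_ (M : nat) (r g d : R) : R :=
  2 * f_ M (-1) g d - f_ M 1 g d - r * (f_ M (-1) g d + 5 * f_ M 0 g d).

Definition R_ (M : nat) (g d : R) : R :=
  3 * F_ M 0 g d + 9 * F_ M (-1) g d + F_ M (-2) g d - 5 * F_ M 1 g d.

Definition r_ (M : nat) (g d : R) : R :=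
  3 * f_ M 0 g d - 9 * f_ M (-1) g d + f_ M (-2) g d + 5 * f_ M 1 g d.

Definition PrRp (M : nat) (r g d : R) : R :=
  P_ M r g d * r_ M g d - R_ M g d * p_ M r g d.

(* Determinant of the matrix with rows (a, b) and (c, d). *)
Definition det2 (a b c d : R) : R := a * d - b * c.

Definition calQ (M : nat) (g d : R) : R :=
  12 * det2 (F_ M 0 g d) (- F_ M (-1) g d)
            (f_ M 0 g d) (f_ M (-1) g d)
  + 5 * det2 (F_ M 0 g d) (F_ M (-2) g d + F_ M 1 g d)
             (f_ M 0 g d) (f_ M (-2) g d - f_ M 1 g d)
  + det2 (- F_ M (-1) g d) (F_ M (-2) g d + F_ M 1 g d)
         (f_ M (-1) g d)   (f_ M (-2) g d - f_ M 1 g d).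

Definition calQm (M : nat) (m : Z) (r g d : R) : R :=
  3 * (1 - 10 * r) * det2 (powerRZ (-1) m * F_ M m g d) (F_ M 0 g d)
                          (f_ M m g d)                  (f_ M 0 g d)
  + 3 * (1 - 2 * r) * det2 (powerRZ (-1) m * F_ M m g d) (- F_ M (-1) g d)
                           (f_ M m g d)                  (f_ M (-1) g d)
  + det2 (powerRZ (-1) m * F_ M m g d) (F_ M (-2) g d + F_ M 1 g d)
         (f_ M m g d)                  (f_ M (-2) g d - f_ M 1 g d).

Definition cot (x : R) : R := cos x / sin x.

(* Sum over the odd k with 1 <= k <= 2N-1. *)
Definition odd_sum (N : nat) (t : nat -> R) : R :=
  sum_f 1 (2 * N - 1) (fun k => if Nat.odd k then t k else 0).

(* Main.v *)
(* A weak maximum principle makes the solution of the lattice system unique, so it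
   suffices to exhibit one.  On the mode sin(k pi (n+N)/(2N)) the system becomes a chain
   in m, solved by B (-1)^m F_m + C f_m on the atomistic side and by multiples of
   sinh((M+m) alpha) on the continuum side; eliminating y(-1), the three layer equations
   reduce to B P + C p = 1, B R + C r = -6, whence B = (r + 6p)/(Pr - Rp) and
   C = -(R + 6P)/(Pr - Rp).  The determinant is nonzero because a kernel vector would
   give a nonzero solution of the homogeneous system.  The constant source is expanded by
   sum_{k odd} cot(k pi/(4N)) sin(k pi j/(2N)) = N for 0 < j < 2N. *)

Require Import Defs.
From Stdlib Require Import Reals ZArith Arith.
From Stdlib Require Import Lra Lia List.

Open Scope R_scope.

(** * Hyperbolic identities and powers of -1 *)

Lemma cosh_plus x y : cosh (x + y) = cosh x * cosh y + sinh x * sinh y.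
Proof.
  unfold cosh, sinh. rewrite Ropp_plus_distr, !exp_plus. field.
Qed.

Lemma sinh_plus x y : sinh (x + y) = sinh x * cosh y + cosh x * sinh y.
Proof.
  unfold cosh, sinh. rewrite Ropp_plus_distr, !exp_plus. field.
Qed.

Lemma cosh_opp x : cosh (- x) = cosh x.
Proof. unfold cosh. rewrite Ropp_involutive. field. Qed.

Lemma sinh_opp x : sinh (- x) = - sinh x.
Proof. unfold sinh. rewrite Ropp_involutive. field. Qed.

Lemma cosh_sqr x : cosh x * cosh x = 1 + sinh x * sinh x.
Proof.
  pose proof (cosh_plus x (- x)) as H.
  rewrite cosh_opp, sinh_opp, Rplus_opp_r, cosh_0 in H. lra.
Qed.

Lemma sinh_pos x : 0 < x -> 0 < sinh x.
Proof. intros Hx. rewrite <- sinh_0. now apply sinh_lt. Qed.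

Lemma cosh_pos x : 0 < cosh x.
Proof. unfold cosh. pose proof (exp_pos x). pose proof (exp_pos (- x)). lra. Qed.

Lemma powerRZ_m1_pred m : powerRZ (-1) (m - 1) = - powerRZ (-1) m.
Proof.
  replace (m - 1)%Z with (m + -1)%Z by lia.
  rewrite powerRZ_add by lra. simpl. field.
Qed.

Lemma powerRZ_m1_succ m : powerRZ (-1) (m + 1) = - powerRZ (-1) m.
Proof. rewrite powerRZ_add by lra. simpl. ring. Qed.

Lemma powerRZ_m1_sqr m : powerRZ (-1) m * powerRZ (-1) m = 1.
Proof.
  assert (Hn : forall n, (-1) ^ n * (-1) ^ n = 1).
  { intros n. rewrite <- Rpow_mult_distr. replace (-1 * -1) with 1 by ring. apply pow1. }
  destruct m; simpl; [ring|apply Hn|]. rewrite <- Rinv_mult, Hn. apply Rinv_1.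
Qed.

(** * The horizontal quasicontinuum operator and the maximum principle *)

(* The part of the left-hand side of (QC) that remains after subtracting the
   second difference [2 y(m,n) - y(m,n-1) - y(m,n+1)]. *)
Definition chain_op (v : Z -> R) (m : Z) : R :=
  if (m <=? -2)%Z then 10 * v m - 5 * v (m - 1)%Z - 5 * v (m + 1)%Z
  else if (m =? -1)%Z then 21 / 2 * v m - 5 * v (m - 1)%Z - 5 * v (m + 1)%Z - 1 / 2 * v (m + 2)%Z
  else if (m =? 0)%Z then 7 * v m - 5 * v (m - 1)%Z - v (m + 1)%Z - v (m + 2)%Z
  else if (m =? 1)%Z then
    7 / 2 * v m - v (m - 1)%Z - v (m + 1)%Z - 1 / 2 * v (m - 2)%Z - v (m + 2)%Z
  else 4 * v m - v (m - 1)%Z - v (m + 1)%Z - v (m - 2)%Z - v (m + 2)%Z.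

Definition layer_source (m : Z) : R :=
  if (m =? 0)%Z then 2 else if (Z.abs m =? 1)%Z then -1 else 0.

Definition second_diff (v : Z -> R) (n : Z) : R :=
  2 * v n - v (n - 1)%Z - v (n + 1)%Z.

(** All five families of (QC) in one equation. The free factor [c] also covers the homogeneous
    system, [c = 0], to which differences of solutions belong. *)
Definition solves_chain (M N : nat) (c : R) (y : Z -> Z -> R) : Prop :=
  forall m n : Z,
    (- Z.of_nat M + 1 <= m <= Z.of_nat M - 1)%Z ->
    (- Z.of_nat N + 1 <= n <= Z.of_nat N - 1)%Z ->
    chain_op (fun j => y j n) m + second_diff (y m) n = c * layer_source m.

Ltac chain_cases m :=
  unfold chain_op, layer_source;
  destruct (Z.leb_spec m (-2)); [| destruct (Z.eqb_spec m (-1)); [subst m |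
  destruct (Z.eqb_spec m 0); [subst m | destruct (Z.eqb_spec m 1); [subst m |]]]];
  repeat match goal with
  | |- context [(?a =? ?b)%Z] => destruct (Z.eqb_spec a b); try lia
  end;
  cbn [Z.add Z.sub Z.opp Z.pos_sub Pos.add Pos.succ Z.succ_double Z.pred_double
       Z.double Pos.pred_double].

Lemma QC_system_solves_chain M N y :
  QC_system M N y -> solves_chain M N (bond_length M) y.
Proof.
  intros [H1 H2 H3 H4 H5] m n Hm Hn. unfold second_diff.
  chain_cases m.
  - specialize (H1 m n ltac:(lia) Hn). lra.
  - specialize (H3 n Hn). lra.
  - specialize (H4 n Hn). lra.
  - specialize (H5 n Hn). lra.
  - specialize (H2 m n ltac:(lia) Hn). lra.
Qed.

Lemma chain_op_minus v w m :
  chain_op (fun j => v j - w j) m = chain_op v m - chain_op w m.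
Proof. chain_cases m; lra. Qed.

Lemma chain_op_scal c v m : chain_op (fun j => v j * c) m = chain_op v m * c.
Proof. chain_cases m; lra. Qed.

Lemma chain_op_sum (V : nat -> Z -> R) K m :
  chain_op (fun j => sum_f_R0 (fun i => V i j) K) m =
  sum_f_R0 (fun i => chain_op (V i) m) K.
Proof.
  induction K as [|K IH]; cbn [sum_f_R0]; [reflexivity|].
  rewrite <- IH. chain_cases m; lra.
Qed.

(* Each row of [chain_op] has zero sum and nonpositive off-diagonal entries. *)
Lemma chain_op_at_max (M : nat) v m :
  (2 <= M)%nat -> (- Z.of_nat M + 1 <= m <= Z.of_nat M - 1)%Z ->
  (forall j, (- Z.of_nat M <= j <= Z.of_nat M + 1)%Z -> v j <= v m) ->
  0 <= chain_op v m.
Proof.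
  intros HM Hm Hv.
  pose proof (Hv (m - 1)%Z ltac:(lia)) as Hl.
  pose proof (Hv (m + 1)%Z ltac:(lia)) as Hr.
  revert Hm Hv Hl Hr. chain_cases m; intros Hm Hv Hl Hr.
  - lra.
  - pose proof (Hv 1%Z ltac:(lia)). lra.
  - pose proof (Hv 2%Z ltac:(lia)). lra.
  - pose proof (Hv (-1)%Z ltac:(lia)). pose proof (Hv 3%Z ltac:(lia)). lra.
  - pose proof (Hv (m - 2)%Z ltac:(lia)). pose proof (Hv (m + 2)%Z ltac:(lia)). lra.
Qed.

Lemma list_argmax {A : Type} (f : A -> R) (l : list A) (a : A) :
  In a l -> exists x, In x l /\ forall y, In y l -> f y <= f x.
Proof.
  revert a. induction l as [|b l IH]; intros a Ha; [easy|].
  destruct l as [|c l].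
  - exists b. split; [now left|]. intros y [<-|[]]. lra.
  - destruct (IH c (or_introl eq_refl)) as [x [Hx Hmax]].
    destruct (Rle_dec (f b) (f x)) as [Hb|Hb].
    + exists x. split; [now right|]. intros y [<-|Hy]; auto.
    + exists b. split; [now left|]. intros y [<-|Hy]; [lra|].
      specialize (Hmax y Hy). lra.
Qed.

(** The rectangle is enumerated as a finite nonempty list of pairs, on which a maximum is
    attained. *)
Lemma rectangle_argmax (u : Z -> Z -> R) (a b c d : Z) :
  (a <= b)%Z -> (c <= d)%Z ->
  exists m0 n0, (a <= m0 <= b)%Z /\ (c <= n0 <= d)%Z /\
    forall m n, (a <= m <= b)%Z -> (c <= n <= d)%Z -> u m n <= u m0 n0.
Proof.
  intros Hab Hcd.
  set (range x y := map (fun i => (x + Z.of_nat i)%Z) (seq 0 (Z.to_nat (y - x + 1)))).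
  assert (Hrange : forall x y z, In z (range x y) <-> (x <= z <= y)%Z).
  { intros x y z. unfold range. rewrite in_map_iff. split.
    - intros [i [<- Hi]]. apply in_seq in Hi. lia.
    - intros Hz. exists (Z.to_nat (z - x)). rewrite in_seq. lia. }
  destruct (list_argmax (fun q => u (fst q) (snd q))
              (list_prod (range a b) (range c d)) (a, c)) as [[m0 n0] [Hin Hmax]].
  { apply in_prod_iff. rewrite !Hrange. lia. }
  apply in_prod_iff in Hin. rewrite !Hrange in Hin.
  exists m0, n0. split; [tauto|]. split; [tauto|].
  intros m n Hm Hn. apply (Hmax (m, n)).
  apply in_prod_iff. rewrite !Hrange. tauto.
Qed.

(* A positive maximum at [(m0, n0)] would propagate to [(m0, n0 + 1)], and so on
   up to the boundary [n = N]. *)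
Lemma solves_chain_nonpos M N u :
  (2 <= M)%nat -> solves_chain M N 0 u -> boundary_conditions M N u ->
  forall m n, (- Z.of_nat M <= m <= Z.of_nat M)%Z -> (- Z.of_nat N <= n <= Z.of_nat N)%Z ->
  u m n <= 0.
Proof.
  intros HM Hu [Hv Hh] m n Hm Hn.
  (* The rectangle includes the column [M + 1], since the row at [M - 1] reaches it. *)
  destruct (rectangle_argmax u (- Z.of_nat M) (Z.of_nat M + 1) (- Z.of_nat N) (Z.of_nat N))
    as (m0 & n0 & Hm0 & Hn0 & Hmax); [lia|lia|].
  apply Rle_trans with (u m0 n0); [apply Hmax; lia|].
  destruct (Rle_dec (u m0 n0) 0) as [|Hpos]; [assumption|exfalso].
  assert (Hint : (- Z.of_nat M + 1 <= m0 <= Z.of_nat M - 1)%Z).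
  { destruct (Hv n0 Hn0) as [E1 [E2 E3]].
    assert (m0 <> - Z.of_nat M)%Z by (intros ->; lra).
    assert (m0 <> Z.of_nat M)%Z by (intros ->; lra).
    assert (m0 <> Z.of_nat M + 1)%Z by (intros ->; lra).
    lia. }
  assert (Hprop : forall j : nat, (n0 + Z.of_nat j <= Z.of_nat N)%Z ->
            u m0 (n0 + Z.of_nat j)%Z = u m0 n0).
  { induction j as [|j IH]; intros Hj; [f_equal; lia|].
    specialize (IH ltac:(lia)). set (q := (n0 + Z.of_nat j)%Z) in *.
    destruct (Hh m0 ltac:(lia)) as [E1 E2].
    assert (q <> - Z.of_nat N)%Z by (intros E; rewrite E in IH; lra).
    assert (Hq : (- Z.of_nat N + 1 <= q <= Z.of_nat N - 1)%Z) by lia.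
    (* At a maximum [chain_op] is nonnegative and both vertical neighbours are at most the maximum,
       so a zero total forces equality with both. *)
    pose proof (Hu m0 q Hint Hq) as Heq. unfold second_diff in Heq.
    assert (0 <= chain_op (fun i => u i q) m0).
    { apply (chain_op_at_max M); [lia|lia|].
      intros i Hi. rewrite IH. apply Hmax; lia. }
    pose proof (Hmax m0 (q - 1)%Z ltac:(lia) ltac:(lia)).
    pose proof (Hmax m0 (q + 1)%Z ltac:(lia) ltac:(lia)).
    replace (n0 + Z.of_nat (S j))%Z with (q + 1)%Z by (unfold q; lia).
    lra. }
  specialize (Hprop (Z.to_nat (Z.of_nat N - n0)) ltac:(lia)).
  replace (n0 + Z.of_nat (Z.to_nat (Z.of_nat N - n0)))%Z with (Z.of_nat N) in Hprop by lia.
  destruct (Hh m0 ltac:(lia)) as [_ E]. lra.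
Qed.

(** Differences of two solutions in either order are homogeneous solutions, hence nonpositive. *)
Lemma solves_chain_unique M N c y z :
  (2 <= M)%nat -> solves_chain M N c y -> solves_chain M N c z ->
  boundary_conditions M N y -> boundary_conditions M N z ->
  forall m n, (- Z.of_nat M <= m <= Z.of_nat M)%Z -> (- Z.of_nat N <= n <= Z.of_nat N)%Z ->
  y m n = z m n.
Proof.
  intros HM.
  assert (Hle : forall y z, solves_chain M N c y -> solves_chain M N c z ->
            boundary_conditions M N y -> boundary_conditions M N z ->
            forall m n, (- Z.of_nat M <= m <= Z.of_nat M)%Z ->
            (- Z.of_nat N <= n <= Z.of_nat N)%Z -> y m n <= z m n).
  { clear y z. intros y z Hy Hz [By1 By2] [Bz1 Bz2] m n Hm Hn.
    enough (y m n - z m n <= 0) by lra.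
    apply (solves_chain_nonpos M N (fun i j => y i j - z i j)); try assumption.
    - intros i j Hi Hj. rewrite chain_op_minus.
      pose proof (Hy i j Hi Hj). pose proof (Hz i j Hi Hj).
      unfold second_diff in *. lra.
    - split.
      + intros j Hj. destruct (By1 j Hj) as (? & ? & ?), (Bz1 j Hj) as (? & ? & ?). lra.
      + intros i Hi. destruct (By2 i Hi), (Bz2 i Hi). lra. }
  intros Hy Hz By Bz m n Hm Hn. apply Rle_antisym; apply Hle; assumption.
Qed.

(** * The modes of the atomistic and continuum regions *)

(** For even [M] and [g], [d] satisfying the characteristic equations, these are solutions of the
    fourth-order atomistic recurrence that vanish at [M] and [M + 1]; [B] and [C] are the two
    parameters left free. *)
Definition atom_mode (M : nat) (g d B C : R) (m : Z) : R :=
  B * (powerRZ (-1) m * F_ M m g d) + C * f_ M m g d.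

(* The factor [z(-1) + 5 z(0)], for the atomistic mode [z] extended to [m = -1],
   comes from subtracting the equation of layer -1 from that of layer 1. *)
Definition mode (M : nat) (a g d B C : R) (m : Z) : R :=
  if (m <? 0)%Z then
    rho M a * (atom_mode M g d B C (-1) + 5 * atom_mode M g d B C 0)
    * (sinh (IZR (Z.of_nat M + m) * a) / sinh (INR (M - 1) * a))
  else atom_mode M g d B C m.

(* [cosh d] and [- cosh g] are the two roots of
   [4 c^2 + 2 c = 6 + 2 l], the characteristic equation of the atomistic rows. *)
Lemma atom_mode_rec M g d B C l m :
  4 * (cosh g)^2 - 2 * cosh g = 6 + 2 * l ->
  4 * (cosh d)^2 + 2 * cosh d = 6 + 2 * l ->
  let z := atom_mode M g d B C in
  (4 + 2 * l) * z m = z (m - 1)%Z + z (m + 1)%Z + z (m - 2)%Z + z (m + 2)%Z.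
Proof.
  intros Hg Hd z.
  set (X := IZR (Z.of_nat M - m)).
  pose proof (cosh_pos g). pose proof (cosh_pos d).
  pose proof (powerRZ_m1_sqr m) as Hs.
  (* In the [F_] part the two factors (-1)^j in front of cosh cancel. So the [g]-terms alternate in
     sign with [j], while the [d]-terms do not. *)
  assert (Hz : forall j s t, IZR (Z.of_nat M - j) = X + t ->
    powerRZ (-1) j = s ->  s * s = 1 ->
    z j = ((B * s) * (sinh ((X + t) * g + g) + sinh ((X + t) * g) * cosh d)
           - B * cosh ((X + t) * d) * sinh g
           + C * (sinh ((X + t) * d + d) + sinh ((X + t) * d) * cosh g)
           - C * s * cosh ((X + t) * g) * sinh d) / (cosh g + cosh d)).
  { intros j s t Ht Hsj Hss. unfold z, atom_mode, f_, F_.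
    rewrite Hsj.
    replace (IZR (Z.of_nat M + 1 - j)) with (X + t + 1)
      by (rewrite <- Ht, <- plus_IZR; f_equal; lia).
    rewrite Ht.
    replace ((X + t + 1) * g) with ((X + t) * g + g) by ring.
    replace ((X + t + 1) * d) with ((X + t) * d + d) by ring.
    set (c1 := cosh ((X + t) * d)). set (c2 := cosh ((X + t) * g)).
    transitivity ((B * s * (sinh ((X + t) * g + g) + sinh ((X + t) * g) * cosh d)
           - B * (s * s) * c1 * sinh g
           + C * (sinh ((X + t) * d + d) + sinh ((X + t) * d) * cosh g)
           - C * s * c2 * sinh d) / (cosh g + cosh d)); [field; lra|].
    rewrite Hss. field. lra. }
  assert (HX : forall t, IZR (Z.of_nat M - (m + t)) = X + IZR (- t)).
  { intros t. unfold X. rewrite <- plus_IZR. f_equal. lia. }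
  set (s := powerRZ (-1) m) in *.
  assert (Em1 : powerRZ (-1) (m - 1) = - s) by apply powerRZ_m1_pred.
  assert (Ep1 : powerRZ (-1) (m + 1) = - s) by apply powerRZ_m1_succ.
  assert (Em2 : powerRZ (-1) (m - 2) = s).
  { replace (m - 2)%Z with (m - 1 - 1)%Z by lia. rewrite powerRZ_m1_pred, Em1. ring. }
  assert (Ep2 : powerRZ (-1) (m + 2) = s).
  { replace (m + 2)%Z with (m + 1 + 1)%Z by lia. rewrite powerRZ_m1_succ, Ep1. ring. }
  rewrite (Hz m s 0), (Hz (m - 1)%Z (- s) 1), (Hz (m + 1)%Z (- s) (-1)),
    (Hz (m - 2)%Z s 2), (Hz (m + 2)%Z s (-2));
    try assumption; try reflexivity; try apply (HX (-1)%Z);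
    try apply (HX 1%Z); try apply (HX (-2)%Z);
    try apply (HX 2%Z); try (unfold X; ring); try (rewrite <- Hs; ring).
  assert (Hsh : forall x h, sinh (x + h) + sinh (x + - h) = 2 * cosh h * sinh x).
  { intros x h. rewrite !sinh_plus, cosh_opp, sinh_opp. ring. }
  assert (Hch : forall x h, cosh (x + h) + cosh (x + - h) = 2 * cosh h * cosh x).
  { intros x h. rewrite !cosh_plus, cosh_opp, sinh_opp. ring. }
  assert (H2 : forall x, cosh (2 * x) = 2 * (cosh x)^2 - 1).
  { intros x. replace (2 * x) with (x + x) by ring. rewrite cosh_plus.
    pose proof (cosh_sqr x). nra. }
  pose proof (Hsh (X * g + g) g) as A1. pose proof (Hsh (X * g + g) (2 * g)) as A2.
  pose proof (Hsh (X * g) g) as A3. pose proof (Hsh (X * g) (2 * g)) as A4.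
  pose proof (Hsh (X * d + d) d) as A5. pose proof (Hsh (X * d + d) (2 * d)) as A6.
  pose proof (Hsh (X * d) d) as A7. pose proof (Hsh (X * d) (2 * d)) as A8.
  pose proof (Hch (X * g) g) as A9. pose proof (Hch (X * g) (2 * g)) as A10.
  pose proof (Hch (X * d) d) as A11. pose proof (Hch (X * d) (2 * d)) as A12.
  rewrite H2 in A2, A4, A6, A8, A10, A12.
  rewrite !Rplus_0_r.
  replace ((X + 1) * g) with (X * g + g) by ring.
  replace ((X + -1) * g) with (X * g + - g) by ring.
  replace ((X + 2) * g) with (X * g + 2 * g) by ring.
  replace ((X + -2) * g) with (X * g + - (2 * g)) by ring.
  replace ((X + 1) * d) with (X * d + d) by ring.
  replace ((X + -1) * d) with (X * d + - d) by ring.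
  replace ((X + 2) * d) with (X * d + 2 * d) by ring.
  replace ((X + -2) * d) with (X * d + - (2 * d)) by ring.
  replace (X * g + - g + g) with (X * g + g + - g) by ring.
  replace (X * d + - d + d) with (X * d + d + - d) by ring.
  replace (X * g + 2 * g + g) with (X * g + g + 2 * g) by ring.
  replace (X * d + 2 * d + d) with (X * d + d + 2 * d) by ring.
  replace (X * g + - (2 * g) + g) with (X * g + g + - (2 * g)) by ring.
  replace (X * d + - (2 * d) + d) with (X * d + d + - (2 * d)) by ring.
  unfold Rdiv. rewrite <- Rmult_assoc, <- !(Rmult_plus_distr_r _ _ (/ (cosh g + cosh d))). f_equal.
  set (G1 := sinh (X * g + g)) in *. set (G0 := sinh (X * g)) in *.
  set (D1 := sinh (X * d + d)) in *. set (D0 := sinh (X * d)) in *.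
  set (CG := cosh (X * g)) in *. set (CD := cosh (X * d)) in *.
  (* Multiplication by [4 + 2 * l] is summation over the four neighbours: the nearest ones enter
     with a minus sign on the alternating [g]-terms and with a plus sign on the [d]-terms. *)
  assert (E1 : forall t, (4 + 2 * l) * t = 2 * (2 * cosh g ^ 2 - 1) * t - 2 * cosh g * t).
  { intros t. replace (4 + 2 * l) with (4 * cosh g ^ 2 - 2 * cosh g - 2) by lra. ring. }
  assert (E2 : forall t, (4 + 2 * l) * t = 2 * (2 * cosh d ^ 2 - 1) * t + 2 * cosh d * t).
  { intros t. replace (4 + 2 * l) with (4 * cosh d ^ 2 + 2 * cosh d - 2) by lra. ring. }
  pose proof (E1 G1) as B1. pose proof (E1 G0) as B2. pose proof (E1 CG) as B3.
  pose proof (E2 D1) as B4. pose proof (E2 D0) as B5. pose proof (E2 CD) as B6.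
  rewrite <- A1, <- A2 in B1. rewrite <- A3, <- A4 in B2. rewrite <- A9, <- A10 in B3.
  rewrite <- A5, <- A6 in B4. rewrite <- A7, <- A8 in B5. rewrite <- A11, <- A12 in B6.
  transitivity (B * s * ((4 + 2 * l) * G1 + (4 + 2 * l) * G0 * cosh d)
    - B * ((4 + 2 * l) * CD) * sinh g
    + C * ((4 + 2 * l) * D1 + (4 + 2 * l) * D0 * cosh g)
    - C * s * ((4 + 2 * l) * CG) * sinh d); [ring|].
  rewrite B1, B2, B3, B4, B5, B6. ring.
Qed.

Lemma mode_neg M a g d B C m : (m < 0)%Z ->
  mode M a g d B C m =
  rho M a * (atom_mode M g d B C (-1) + 5 * atom_mode M g d B C 0)
  * (sinh (IZR (Z.of_nat M + m) * a) / sinh (INR (M - 1) * a)).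
Proof. intros H. unfold mode. now rewrite (proj2 (Z.ltb_lt _ _) H). Qed.

Lemma mode_nonneg M a g d B C m : (0 <= m)%Z ->
  mode M a g d B C m = atom_mode M g d B C m.
Proof. intros H. unfold mode. now rewrite (proj2 (Z.ltb_ge _ _) H). Qed.

(** Away from the interface both profiles satisfy their recurrences exactly. Rows -1 and 1 leave the
    same residual because the value at -1 is [rho] times z(-1) + 5 z(0), with z the extended
    atomistic mode; only the two conditions [b1] and [b2] remain. *)
Lemma chain_op_mode M a g d B C l m :
  (2 <= M)%nat -> 0 < a -> cosh a = 1 + l / 5 ->
  4 * (cosh g)^2 - 2 * cosh g = 6 + 2 * l ->
  4 * (cosh d)^2 + 2 * cosh d = 6 + 2 * l ->
  let b1 := B * P_ M (rho M a) g d + C * p_ M (rho M a) g d in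
  let b2 := B * R_ M g d + C * r_ M g d in
  chain_op (mode M a g d B C) m + 2 * l * mode M a g d B C m =
  if (m =? 0)%Z then b2 + 5 * b1 else if (Z.abs m =? 1)%Z then b1 / 2 else 0.
Proof.
  intros HM Ha Hl Hg Hd b1 b2.
  pose proof (atom_mode_rec M g d B C l) as Hrec.
  specialize (fun j => Hrec j Hg Hd). cbv zeta in Hrec.
  assert (HM1 : 1 <= INR (M - 1)).
  { replace 1 with (INR 1) by reflexivity. apply le_INR. lia. }
  assert (EM : INR M = INR (M - 1) + 1).
  { rewrite minus_INR by lia. simpl. ring. }
  assert (S1 : 0 < sinh (INR (M - 1) * a)) by (apply sinh_pos; nra).
  assert (S0 : 0 < sinh (INR M * a)) by (apply sinh_pos; nra).
  set (K := atom_mode M g d B C (-1) + 5 * atom_mode M g d B C 0).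
  assert (HX : forall j, IZR (Z.of_nat M + j) = INR M + IZR j).
  { intros j. now rewrite plus_IZR, INR_IZR_INZ. }
  assert (Hsh : forall x, 5 * (sinh ((x - 1) * a) + sinh ((x + 1) * a))
                          = (10 + 2 * l) * sinh (x * a)).
  { intros x. replace ((x - 1) * a) with (x * a + - a) by ring.
    replace ((x + 1) * a) with (x * a + a) by ring.
    rewrite !sinh_plus, cosh_opp, sinh_opp.
    replace l with (5 * (cosh a - 1)) by lra. ring. }
  chain_cases m.
  - rewrite !(mode_neg _ _ _ _ _ _ m), (mode_neg _ _ _ _ _ _ (m - 1)),
      (mode_neg _ _ _ _ _ _ (m + 1)) by lia.
    fold K. rewrite !HX, minus_IZR, plus_IZR.
    specialize (Hsh (INR M + IZR m)).
    replace (INR M + (IZR m - 1)) with (INR M + IZR m - 1) by ring.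
    replace (INR M + (IZR m + 1)) with (INR M + IZR m + 1) by ring.
    transitivity (rho M a * K / sinh (INR (M - 1) * a) *
      ((10 + 2 * l) * sinh ((INR M + IZR m) * a) -
       5 * (sinh ((INR M + IZR m - 1) * a) + sinh ((INR M + IZR m + 1) * a))));
      [field; lra|].
    rewrite Hsh. ring.
  - rewrite (mode_neg _ _ _ _ _ _ (-1)), (mode_neg _ _ _ _ _ _ (-2)),
      !mode_nonneg by lia.
    fold K. rewrite !HX.
    specialize (Hsh (INR M - 1)).
    replace (INR M + -1) with (INR M - 1) by ring.
    replace (INR M + -2) with (INR M - 1 - 1) by ring.
    replace (INR M - 1 + 1) with (INR M) in Hsh by ring.
    replace (INR M - 1) with (INR (M - 1)) in * by lra.
    (* The definition of [rho] in the form in which row -1 uses it, where the sinh profile is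
       continued to m = 0. *)
    assert (Hrho : 5 * rho M a * sinh (INR M * a) / sinh (INR (M - 1) * a) = 1 - rho M a).
    { unfold rho. field. lra. }
    transitivity (rho M a * K / 2
      + rho M a * K / sinh (INR (M - 1) * a) *
        ((10 + 2 * l) * sinh (INR (M - 1) * a)
         - 5 * sinh ((INR (M - 1) - 1) * a))
      - 5 * atom_mode M g d B C 0 - 1 / 2 * atom_mode M g d B C 1); [field; lra|].
    rewrite <- Hsh.
    transitivity (rho M a * K / 2
      + K * (5 * rho M a * sinh (INR M * a) / sinh (INR (M - 1) * a))
      - 5 * atom_mode M g d B C 0 - 1 / 2 * atom_mode M g d B C 1); [field; lra|].
    rewrite Hrho. unfold K, b1, P_, p_, atom_mode. simpl. field.
  - rewrite (mode_neg _ _ _ _ _ _ (-1)), !mode_nonneg by lia.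
    fold K. rewrite !HX.
    replace (INR M + -1) with (INR (M - 1)) by lra.
    (* The recurrence is applied to the atomistic mode extended to -1 and -2, where it differs from
       [mode] in general; this is how the indices -1 and -2 enter the layer coefficients. *)
    specialize (Hrec 0%Z). simpl in Hrec.
    transitivity ((4 + 2 * l) * atom_mode M g d B C 0 + 3 * atom_mode M g d B C 0
       - 5 * (rho M a * K) - atom_mode M g d B C 1 - atom_mode M g d B C 2); [field; lra|].
    rewrite Hrec. unfold K, b1, b2, P_, p_, R_, r_, atom_mode. simpl. field.
  - rewrite (mode_neg _ _ _ _ _ _ (-1)), !mode_nonneg by lia.
    fold K. rewrite !HX.
    replace (INR M + -1) with (INR (M - 1)) by lra.
    specialize (Hrec 1%Z). simpl in Hrec.
    transitivity ((4 + 2 * l) * atom_mode M g d B C 1 - 1 / 2 * atom_mode M g d B C 1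
       - atom_mode M g d B C 0 - atom_mode M g d B C 2
       - 1 / 2 * (rho M a * K) - atom_mode M g d B C 3); [field; lra|].
    rewrite Hrec. unfold K, b1, P_, p_, atom_mode. simpl. field.
  - rewrite !mode_nonneg by lia. specialize (Hrec m). lra.
Qed.

Lemma mode_left_end M a g d B C : (0 < M)%nat -> mode M a g d B C (- Z.of_nat M) = 0.
Proof.
  intros HM. rewrite mode_neg by lia.
  replace (Z.of_nat M + - Z.of_nat M)%Z with 0%Z by lia.
  rewrite Rmult_0_l, sinh_0. unfold Rdiv. ring.
Qed.

Lemma powerRZ_m1_even M : Nat.Even M -> powerRZ (-1) (Z.of_nat M) = 1.
Proof.
  intros [h ->]. replace (Z.of_nat (2 * h)) with (Z.of_nat h + Z.of_nat h)%Z by lia.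
  rewrite powerRZ_add by lra. apply powerRZ_m1_sqr.
Qed.

(** The numerators cancel because (-1)^M = 1; this is where the parity of [M] enters. *)
Lemma mode_right_end M a g d B C : Nat.Even M ->
  mode M a g d B C (Z.of_nat M) = 0 /\ mode M a g d B C (Z.of_nat M + 1) = 0.
Proof.
  intros HM. rewrite !mode_nonneg by lia. unfold atom_mode, f_, F_.
  rewrite powerRZ_m1_succ, powerRZ_m1_even by assumption.
  pose proof (cosh_pos g). pose proof (cosh_pos d).
  split.
  - replace (Z.of_nat M + 1 - Z.of_nat M)%Z with 1%Z by lia.
    rewrite Z.sub_diag, !Rmult_0_l, !Rmult_1_l, sinh_0, cosh_0. field. lra.
  - rewrite Z.sub_diag. replace (Z.of_nat M - (Z.of_nat M + 1))%Z with (-1)%Z by lia.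
    replace (-1 * g) with (- g) by ring. replace (-1 * d) with (- d) by ring.
    rewrite !Rmult_0_l, sinh_0, !sinh_opp, !cosh_opp. field. lra.
Qed.

(** * Linear independence of the two atomistic modes *)

Lemma F_pred M g d : Nat.Even M -> F_ M (Z.of_nat M - 1) g d = 2 * sinh g.
Proof.
  intros HM. unfold F_.
  replace (Z.of_nat M + 1 - (Z.of_nat M - 1))%Z with 2%Z by lia.
  replace (Z.of_nat M - (Z.of_nat M - 1))%Z with 1%Z by lia.
  rewrite powerRZ_m1_pred, powerRZ_m1_even by assumption.
  replace (2 * g) with (g + g) by ring. rewrite !Rmult_1_l, sinh_plus.
  pose proof (cosh_pos g). pose proof (cosh_pos d). field. lra.
Qed.

Lemma F_pred2 M g d : Nat.Even M ->
  F_ M (Z.of_nat M - 2) g d = 2 * sinh g * (2 * cosh g - cosh d).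
Proof.
  intros HM. unfold F_.
  replace (Z.of_nat M + 1 - (Z.of_nat M - 2))%Z with 3%Z by lia.
  replace (Z.of_nat M - (Z.of_nat M - 2))%Z with 2%Z by lia.
  replace (Z.of_nat M - 2)%Z with (Z.of_nat M - 1 - 1)%Z by lia.
  rewrite !powerRZ_m1_pred, powerRZ_m1_even by assumption.
  replace (3 * g) with (g + g + g) by ring. replace (2 * g) with (g + g) by ring.
  replace (2 * d) with (d + d) by ring.
  rewrite !sinh_plus, !cosh_plus.
  pose proof (cosh_pos g). pose proof (cosh_pos d).
  pose proof (cosh_sqr g) as Eg. pose proof (cosh_sqr d) as Ed.
  assert (Eg' : sinh g * sinh g = cosh g * cosh g - 1) by lra.
  assert (Ed' : sinh d * sinh d = cosh d * cosh d - 1) by lra.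
  apply (Rmult_eq_reg_r (cosh g + cosh d)); [|lra].
  unfold Rdiv. rewrite Rmult_assoc, Rinv_l, Rmult_1_r by lra.
  rewrite Ed'.
  (* The numerator is sinh g times 4 cosh^2 g + 2 cosh g cosh d - 2 cosh^2 d, and the latter factors
     as 2 (2 cosh g - cosh d)(cosh g + cosh d). *)
  transitivity (sinh g * (2 * (cosh g * cosh g) + 2 * cosh g * cosh d
    + cosh g * cosh g + sinh g * sinh g
    - (cosh d * cosh d + (cosh d * cosh d - 1)))); [ring|].
  rewrite Eg'. ring.
Qed.

(** The value at [M - 1] gives B sinh g = C sinh d; inserted at [M - 2] this leaves 2 B sinh g (cosh
    g + cosh d) = 0. *)
Lemma mode_injective M a g d B C :
  (2 <= M)%nat -> Nat.Even M -> 0 < g -> 0 < d ->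
  mode M a g d B C (Z.of_nat M - 1) = 0 -> mode M a g d B C (Z.of_nat M - 2) = 0 ->
  B = 0 /\ C = 0.
Proof.
  intros HM Hev Hg Hd E1 E2.
  rewrite mode_nonneg in E1, E2 by lia. unfold atom_mode, f_ in E1, E2.
  rewrite !F_pred in E1 by assumption. rewrite !F_pred2 in E2 by assumption.
  rewrite powerRZ_m1_pred, powerRZ_m1_even in E1 by assumption.
  replace (powerRZ (-1) (Z.of_nat M - 2)) with 1 in E2.
  2:{ replace (Z.of_nat M - 2)%Z with (Z.of_nat M - 1 - 1)%Z by lia.
      rewrite !powerRZ_m1_pred, powerRZ_m1_even by assumption. ring. }
  pose proof (cosh_pos g). pose proof (cosh_pos d).
  pose proof (sinh_pos g Hg). pose proof (sinh_pos d Hd).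
  assert (HBC : B * sinh g = C * sinh d) by lra.
  assert (B * sinh g * (2 * (cosh g + cosh d)) = 0).
  { replace (B * (1 * (2 * sinh g * (2 * cosh g - cosh d))) +
             C * (2 * sinh d * (2 * cosh d - cosh g)))
      with (2 * (B * sinh g) * (2 * cosh g - cosh d) +
             2 * (C * sinh d) * (2 * cosh d - cosh g)) in E2 by ring.
    rewrite <- HBC in E2. lra. }
  assert (HB : B = 0).
  { destruct (Rmult_integral _ _ H3) as [H4|H4]; [|lra].
    destruct (Rmult_integral _ _ H4); lra. }
  split; [assumption|]. subst B.
  destruct (Rmult_integral C (sinh d)); lra.
Qed.

(** * The discrete sine expansion in the vertical direction *)

Definition sine_mode (N k : nat) (n : Z) : R :=
  sin (INR k * PI / (2 * INR N) * IZR (n + Z.of_nat N)).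

Lemma second_diff_sine_mode N k n : (0 < N)%nat ->
  second_diff (sine_mode N k) n = 2 * lambda N k * sine_mode N k n.
Proof.
  intros HN. unfold second_diff, sine_mode, lambda.
  pose proof (lt_0_INR N HN).
  rewrite !plus_IZR, minus_IZR.
  set (x := IZR n + IZR (Z.of_nat N)). set (t := INR k * PI / (4 * INR N)).
  replace (INR k * PI / (2 * INR N)) with (2 * t) by (unfold t; field; lra).
  replace (2 * t * (IZR n - 1 + IZR (Z.of_nat N))) with (2 * t * x - 2 * t)
    by (unfold x; ring).
  replace (2 * t * (IZR n + 1 + IZR (Z.of_nat N))) with (2 * t * x + 2 * t)
    by (unfold x; ring).
  rewrite sin_minus, sin_plus, (cos_2a_sin t). ring.
Qed.

Lemma sine_mode_ends N k : (0 < N)%nat ->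
  sine_mode N k (- Z.of_nat N) = 0 /\ sine_mode N k (Z.of_nat N) = 0.
Proof.
  intros HN. unfold sine_mode. pose proof (lt_0_INR N HN). split.
  - replace (- Z.of_nat N + Z.of_nat N)%Z with 0%Z by lia.
    rewrite Rmult_0_r. apply sin_0.
  - apply sin_eq_0_1. exists (Z.of_nat k).
    rewrite plus_IZR, <- !INR_IZR_INZ. field. lra.
Qed.

Lemma sin_multiple_pos (N j : nat) : (0 < j < 2 * N)%nat ->
  0 < sin (INR j * PI / (2 * INR N)).
Proof.
  intros Hj. assert (0 < INR N) by (apply lt_0_INR; lia).
  assert (0 < INR j) by (apply lt_0_INR; lia).
  assert (INR j < 2 * INR N).
  { replace 2 with (INR 2) by reflexivity. rewrite <- mult_INR. apply lt_INR. lia. }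
  pose proof PI_RGT_0. apply sin_gt_0.
  - apply Rdiv_lt_0_compat; nra.
  - apply (Rmult_lt_reg_r (2 * INR N)); [lra|].
    unfold Rdiv. rewrite Rmult_assoc, Rinv_l; nra.
Qed.

Lemma odd_sum_sum_f_R0 N t : (0 < N)%nat ->
  odd_sum N t = sum_f_R0 (fun i => t (2 * i + 1)%nat) (N - 1).
Proof.
  intros HN. unfold odd_sum, sum_f.
  (* [sum_f] shifts its index to start at 0, so odd [k] sit at even positions; each induction step
     adds one vanishing and one kept term. *)
  replace (2 * N - 1 - 1)%nat with (2 * (N - 1))%nat by lia.
  induction (N - 1)%nat as [|K IH]; [reflexivity|].
  replace (2 * S K)%nat with (S (S (2 * K))) by lia.
  cbn [sum_f_R0]. rewrite IH.
  replace (S (2 * K) + 1)%nat with (2 * (K + 1))%nat by lia.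
  rewrite Nat.odd_even.
  replace (S (S (2 * K)) + 1)%nat with (2 * S K + 1)%nat by lia.
  rewrite Nat.odd_odd. ring.
Qed.

(** The sum telescopes, as 2 sin x cos((2i+1)x) = sin((2i+2)x) - sin(2ix). *)
Lemma sum_cos_odd x K :
  2 * sin x * sum_f_R0 (fun i => cos (INR (2 * i + 1) * x)) K = sin (INR (2 * K + 2) * x).
Proof.
  induction K as [|K IH].
  - simpl. rewrite !Rmult_1_l. replace ((1 + 1) * x) with (2 * x) by ring.
    rewrite sin_2a. reflexivity.
  - cbn [sum_f_R0]. rewrite Rmult_plus_distr_l, IH.
    replace (INR (2 * S K + 1)) with (INR (2 * K + 2) + 1)
      by (rewrite <- S_INR; f_equal; lia).
    replace (INR (2 * S K + 2)) with (INR (2 * K + 2) + 1 + 1)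
      by (rewrite <- !S_INR; f_equal; lia).
    set (q := INR (2 * K + 2)).
    replace (q * x) with ((q + 1) * x - x) by ring.
    replace ((q + 1 + 1) * x) with ((q + 1) * x + x) by ring.
    rewrite sin_minus, sin_plus. ring.
Qed.

(** At x = j pi/(2N) the closed form is sin(j pi) = 0, while sin x > 0. *)
Lemma sum_cos_odd_0 (N j : nat) : (0 < j < 2 * N)%nat ->
  sum_f_R0 (fun i => cos (INR j * (INR (2 * i + 1) * PI / (2 * INR N)))) (N - 1) = 0.
Proof.
  intros Hj. assert (0 < INR N) by (apply lt_0_INR; lia).
  pose proof (sin_multiple_pos N j Hj) as Hs.
  pose proof (sum_cos_odd (INR j * PI / (2 * INR N)) (N - 1)) as E.
  replace (sin (INR (2 * (N - 1) + 2) * (INR j * PI / (2 * INR N)))) with 0 in E.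
  2:{ symmetry. apply sin_eq_0_1. exists (Z.of_nat j).
      replace (2 * (N - 1) + 2)%nat with (2 * N)%nat by lia.
      rewrite mult_INR, <- INR_IZR_INZ. simpl. field. lra. }
  apply Rmult_integral in E. destruct E as [E|E]; [lra|].
  rewrite <- E. apply sum_eq. intros i _. f_equal. field. lra.
Qed.

(* Successive differences in [j] of the left-hand side are sums of cosines over odd
   multiples, which vanish. *)
Lemma sum_cot_sin (N j : nat) : (0 < j < 2 * N)%nat ->
  sum_f_R0 (fun i => cot (INR (2 * i + 1) * PI / (4 * INR N))
                     * sin (INR j * (INR (2 * i + 1) * PI / (2 * INR N)))) (N - 1) = INR N.
Proof.
  intros Hj. assert (HN : 0 < INR N) by (apply lt_0_INR; lia).
  set (S j := sum_f_R0 (fun i => cot (INR (2 * i + 1) * PI / (4 * INR N))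
                     * sin (INR j * (INR (2 * i + 1) * PI / (2 * INR N)))) (N - 1)).
  change (S j = INR N).
  (* With t = (2i+1) pi/(4N), the difference of sines is 2 cos((2q+1)t) sin t; the cotangent turns
     it into 2 cos((2q+1)t) cos t, a sum of two cosines. *)
  assert (Hstep : forall q, S (q + 1)%nat - S q =
     sum_f_R0 (fun i => cos (INR (q + 1) * (INR (2 * i + 1) * PI / (2 * INR N)))) (N - 1)
     + sum_f_R0 (fun i => cos (INR q * (INR (2 * i + 1) * PI / (2 * INR N)))) (N - 1)).
  { intros q. unfold S. rewrite <- minus_sum, <- plus_sum. apply sum_eq.
    intros i Hi. set (t := INR (2 * i + 1) * PI / (4 * INR N)).
    replace (INR (2 * i + 1) * PI / (2 * INR N)) with (2 * t) by (unfold t; field; lra).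
    assert (Ht : 0 < sin t).
    { pose proof (sin_multiple_pos (2 * N) (2 * i + 1) ltac:(lia)) as E.
      rewrite (mult_INR 2 N) in E. simpl (INR 2) in E.
      replace (2 * ((1 + 1) * INR N)) with (4 * INR N) in E by ring. exact E. }
    rewrite (plus_INR q 1). simpl (INR 1).
    replace ((INR q + 1) * (2 * t)) with (INR q * (2 * t) + t + t) by ring.
    set (x := INR q * (2 * t)). replace x with (x + t - t) at 2 4 by ring.
    set (z := x + t). rewrite cos_plus, cos_minus, sin_plus, sin_minus.
    unfold cot. field. lra. }
  destruct j as [|j]; [lia|]. induction j as [|j IH].
  (* From 0 to 1 the second cosine sum consists of ones and contributes N; all later steps
     contribute 0. *)
  - specialize (Hstep 0%nat). rewrite sum_cos_odd_0 in Hstep by lia.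
    assert (E0 : S 0%nat = 0).
    { unfold S. rewrite <- (Rmult_0_l (INR (N - 1 + 1))).
      rewrite Nat.add_1_r, <- (sum_cte 0 (N - 1)).
      apply sum_eq. intros i _. simpl (INR 0). rewrite Rmult_0_l, sin_0. ring. }
    rewrite E0 in Hstep. simpl in Hstep. simpl.
    transitivity (sum_f_R0 (fun _ => 1) (N - 1)).
    + rewrite <- (Rplus_0_l (sum_f_R0 _ _)), <- (Rminus_0_r (S 1%nat)), Hstep.
      f_equal. apply sum_eq. intros i _. rewrite Rmult_0_l. apply cos_0.
    + rewrite sum_cte, Rmult_1_l. f_equal. lia.
  - specialize (Hstep (Datatypes.S j)). rewrite !sum_cos_odd_0 in Hstep by lia.
    replace (Datatypes.S j + 1)%nat with (Datatypes.S (Datatypes.S j)) in Hstep by lia.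
    rewrite IH in Hstep by lia. lra.
Qed.

(** * The solution formula *)

(** The square roots are replaced by the quadratics that they solve, the form in which the
    recurrences use them. *)
Record mode_parameters (l a g d : R) : Prop := {
  a_pos : 0 < a;
  g_pos : 0 < g;
  d_pos : 0 < d;
  cosh_a : cosh a = 1 + l / 5;
  cosh_g : 4 * (cosh g)^2 - 2 * cosh g = 6 + 2 * l;
  cosh_d : 4 * (cosh d)^2 + 2 * cosh d = 6 + 2 * l
}.

Lemma hyperbolic_mode_parameters N alpha gamma delta k :
  hyperbolic_parameters N alpha gamma delta -> (1 <= k <= 2 * N - 1)%nat ->
  mode_parameters (lambda N k) (alpha k) (gamma k) (delta k).
Proof.
  intros H Hk. destruct (H k Hk) as [[? ?] [[? Hg] [? Hd]]].
  assert (0 <= lambda N k) by (unfold lambda; nra).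
  pose proof (sqrt_sqrt (25 + 8 * lambda N k) ltac:(lra)).
  split; try assumption; [rewrite Hg|rewrite Hd]; nra.
Qed.

Lemma separated_boundary_conditions M N (K : nat) (z : nat -> Z -> R) (c : nat -> R)
  (k : nat -> nat) :
  (0 < N)%nat ->
  (forall i, z i (- Z.of_nat M)%Z = 0 /\ z i (Z.of_nat M) = 0 /\ z i (Z.of_nat M + 1)%Z = 0) ->
  boundary_conditions M N
    (fun m n => sum_f_R0 (fun i => z i m * (c i * sine_mode N (k i) n)) K).
Proof.
  intros HN Hz.
  assert (Hsum : forall f, (forall i, f i = 0) -> sum_f_R0 f K = 0).
  { intros f Hf. clear - Hf. induction K; simpl; rewrite Hf; lra. }
  split.
  - intros n _. repeat split; apply Hsum; intros i; destruct (Hz i) as (E1 & E2 & E3);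
      rewrite ?E1, ?E2, ?E3; ring.
  - intros m _. split; apply Hsum; intros i;
      destruct (sine_mode_ends N (k i) HN) as [E1 E2]; rewrite ?E1, ?E2; ring.
Qed.

(** Each sine is an eigenfunction of [second_diff] with eigenvalue [2 * lambda N k], so the lattice
    operator acts on each mode separately as a shifted [chain_op]. *)
Lemma separated_chain N (K : nat) (z : nat -> Z -> R) (c : nat -> R) (k : nat -> nat) m n :
  (0 < N)%nat ->
  chain_op (fun j => sum_f_R0 (fun i => z i j * (c i * sine_mode N (k i) n)) K) m
  + second_diff (fun q => sum_f_R0 (fun i => z i m * (c i * sine_mode N (k i) q)) K) n
  = sum_f_R0 (fun i => (chain_op (z i) m + 2 * lambda N (k i) * z i m)
                       * (c i * sine_mode N (k i) n)) K.
Proof.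
  intros HN. rewrite (chain_op_sum (fun i j => z i j * (c i * sine_mode N (k i) n))).
  unfold second_diff. rewrite scal_sum, <- !minus_sum, <- plus_sum.
  apply sum_eq. intros i _. rewrite chain_op_scal.
  pose proof (second_diff_sine_mode N (k i) n HN) as E. unfold second_diff in E.
  transitivity (chain_op (z i) m * (c i * sine_mode N (k i) n) + z i m * c i *
    (2 * sine_mode N (k i) n - sine_mode N (k i) (n - 1) - sine_mode N (k i) (n + 1)));
    [ring|].
  rewrite E. ring.
Qed.

(** Both (p, -P) and (r, -R0) are annihilated by the two rows when the determinant vanishes; if p =
    r = 0, then (0, 1) is. *)
Lemma singular2_kernel (P p R0 r : R) : P * r - R0 * p = 0 ->
  exists B C, (B <> 0 \/ C <> 0) /\ B * P + C * p = 0 /\ B * R0 + C * r = 0.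
Proof.
  intros H.
  destruct (Req_dec p 0) as [Hp|Hp]; [|exists p, (- P); repeat split; [now left|ring|lra]].
  destruct (Req_dec r 0) as [Hr|Hr]; [|exists r, (- R0); repeat split; [now left|lra|ring]].
  exists 0, 1. repeat split; [right|subst|subst]; lra.
Qed.

(* A kernel vector of the layer equations would give a nonzero solution of the
   homogeneous lattice system. *)
Lemma PrRp_neq0 M N k a g d :
  (2 <= M)%nat -> Nat.Even M -> (1 <= k <= 2 * N - 1)%nat ->
  mode_parameters (lambda N k) a g d -> PrRp M (rho M a) g d <> 0.
Proof.
  intros HM Hev Hk [Ha Hg Hd Ea Eg Ed] HD.
  destruct (singular2_kernel _ _ _ _ HD) as (B & C & Hne & E1 & E2).
  assert (HN : (0 < N)%nat) by lia.
  assert (Hzero : forall m, (- Z.of_nat M <= m <= Z.of_nat M)%Z -> mode M a g d B C m = 0).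
  { intros m Hm.
    pose proof (sin_multiple_pos N k ltac:(lia)) as Hs.
    (* The row n = -N + 1 is chosen because the sine there is sin(k pi/(2N)) > 0. The separated
       solution is a one-term sum and is compared with zero. *)
    assert (E : mode M a g d B C m * (1 * sine_mode N k (- Z.of_nat N + 1)) = 0).
    { apply (solves_chain_unique M N 0
        (fun m n => sum_f_R0 (fun _ => mode M a g d B C m * (1 * sine_mode N k n)) 0)
        (fun _ _ => 0)); try lia.
      - intros i j Hi Hj.
        rewrite (separated_chain N 0 (fun _ => mode M a g d B C) (fun _ => 1) (fun _ => k))
          by assumption.
        cbn [sum_f_R0]. rewrite (chain_op_mode M a g d B C (lambda N k)) by assumption.
        rewrite E1, E2. destruct (i =? 0)%Z; [|destruct (Z.abs i =? 1)%Z]; lra.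
      - intros i j _ _. unfold second_diff. chain_cases i; lra.
      - apply (separated_boundary_conditions M N 0 (fun _ => mode M a g d B C) (fun _ => 1)
          (fun _ => k)); [assumption|].
        intros _. split; [apply mode_left_end; lia|now apply mode_right_end].
      - split; intros; auto. }
    unfold sine_mode in E.
    replace (- Z.of_nat N + 1 + Z.of_nat N)%Z with 1%Z in E by lia.
    rewrite Rmult_1_r, Rmult_1_l in E.
    apply Rmult_integral in E. destruct E; lra. }
  destruct (mode_injective M a g d B C HM Hev Hg Hd); try (apply Hzero; lia).
  tauto.
Qed.

(** * Cramer's rule for the layer equations and assembly of the series *)

Definition coef_B (M : nat) (r g d : R) : R :=
  (r_ M g d + 6 * p_ M r g d) / PrRp M r g d.

Definition coef_C (M : nat) (r g d : R) : R :=
  - (R_ M g d + 6 * P_ M r g d) / PrRp M r g d.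

Lemma atom_mode_calQm M m r g d : PrRp M r g d <> 0 ->
  atom_mode M g d (coef_B M r g d) (coef_C M r g d) m = calQm M m r g d / PrRp M r g d.
Proof.
  intros HD. unfold atom_mode, coef_B, coef_C, calQm, det2.
  set (D := PrRp M r g d) in *. unfold P_, p_, R_, r_. field. assumption.
Qed.

(** The [r]-terms of [P_] and [p_] are multiples of this same combination z(-1) + 5 z(0), so they
    cancel and [calQ] does not depend on [r]. *)
Lemma atom_mode_calQ M r g d : PrRp M r g d <> 0 ->
  atom_mode M g d (coef_B M r g d) (coef_C M r g d) (-1)
  + 5 * atom_mode M g d (coef_B M r g d) (coef_C M r g d) 0 = calQ M g d / PrRp M r g d.
Proof.
  intros HD. unfold atom_mode, coef_B, coef_C, calQ, det2.
  set (D := PrRp M r g d) in *. unfold P_, p_, R_, r_. simpl. field. assumption.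
Qed.

Definition solution_mode (M : nat) (a g d : R) : Z -> R :=
  mode M a g d (coef_B M (rho M a) g d) (coef_C M (rho M a) g d).

(** The right-hand sides 1 and -6 leave 1/2 in rows -1 and 1, and -6 + 5 = -1 in row 0. *)
Lemma chain_op_solution_mode M N k a g d m :
  (2 <= M)%nat -> Nat.Even M -> (1 <= k <= 2 * N - 1)%nat ->
  mode_parameters (lambda N k) a g d ->
  chain_op (solution_mode M a g d) m + 2 * lambda N k * solution_mode M a g d m
  = - layer_source m / 2.
Proof.
  intros HM Hev Hk Hpar. pose proof (PrRp_neq0 M N k a g d HM Hev Hk Hpar) as HD.
  destruct Hpar as [Ha Hg Hd Ea Eg Ed].
  unfold solution_mode. rewrite (chain_op_mode M a g d _ _ (lambda N k)) by assumption.
  unfold layer_source, coef_B, coef_C.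
  set (P := P_ M (rho M a) g d). set (p := p_ M (rho M a) g d).
  assert (E : PrRp M (rho M a) g d = P * r_ M g d - R_ M g d * p) by reflexivity.
  rewrite E in *.
  destruct (m =? 0)%Z; [|destruct (Z.abs m =? 1)%Z]; field; assumption.
Qed.

Lemma solution_series M N alpha gamma delta y :
  (0 < M)%nat -> (0 < N)%nat -> Nat.Even M ->
  hyperbolic_parameters N alpha gamma delta ->
  QC_system M N y -> boundary_conditions M N y ->
  forall m n, (- Z.of_nat M <= m <= Z.of_nat M)%Z -> (- Z.of_nat N <= n <= Z.of_nat N)%Z ->
  y m n = - (2 * bond_length M / INR N) *
    odd_sum N (fun k => solution_mode M (alpha k) (gamma k) (delta k) m
                        * (cot (INR k * PI / (4 * INR N)) * sine_mode N k n)).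
Proof.
  intros HM0 HN Hev Hpar Hy By m n Hm Hn.
  assert (HM : (2 <= M)%nat) by (destruct Hev; lia).
  pose proof (lt_0_INR N HN) as HNR.
  (* Each mode produces -1/2 of the source and the cotangent sum equals N, so this factor restores
     [bond_length M]. *)
  set (c := - (2 * bond_length M / INR N)).
  set (k i := (2 * i + 1)%nat).
  set (z i := solution_mode M (alpha (k i)) (gamma (k i)) (delta (k i))).
  set (ct i := c * cot (INR (k i) * PI / (4 * INR N))).
  rewrite odd_sum_sum_f_R0, scal_sum by assumption.
  transitivity (sum_f_R0 (fun i => z i m * (ct i * sine_mode N (k i) n)) (N - 1)).
  2:{ apply sum_eq. intros i _. unfold z, ct, k. ring. }
  apply (solves_chain_unique M N (bond_length M) y
    (fun m n => sum_f_R0 (fun i => z i m * (ct i * sine_mode N (k i) n)) (N - 1)));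
    try assumption.
  - now apply QC_system_solves_chain.
  - clear m n Hm Hn. intros m n Hm Hn. rewrite separated_chain by assumption.
    transitivity (c * (- layer_source m / 2) * INR N); [|unfold c; field; lra].
    (* The index j = n + N satisfies 0 < j < 2N exactly on the interior rows. *)
    rewrite <- (sum_cot_sin N (Z.to_nat (n + Z.of_nat N))) at 1 by lia.
    rewrite scal_sum. apply sum_eq. intros i Hi. unfold z.
    rewrite (chain_op_solution_mode M N (k i));
      [|assumption|assumption|unfold k; lia|
       apply hyperbolic_mode_parameters; [assumption|unfold k; lia]].
    unfold ct, sine_mode. fold (k i).
    rewrite (INR_IZR_INZ (Z.to_nat _)), Z2Nat.id by lia.
    rewrite (Rmult_comm (IZR (n + Z.of_nat N))). ring.
  - apply separated_boundary_conditions; [assumption|].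
    intros i. split; [apply mode_left_end; lia|now apply mode_right_end].
Qed.

Lemma odd_sum_ext N t u : (0 < N)%nat ->
  (forall k, (1 <= k <= 2 * N - 1)%nat -> t k = u k) -> odd_sum N t = odd_sum N u.
Proof.
  intros HN H. rewrite !odd_sum_sum_f_R0 by assumption.
  apply sum_eq. intros i Hi. apply H. lia.
Qed.

Theorem theorem4p3 :
  forall (M N : nat) (alpha gamma delta : nat -> R) (y : Z -> Z -> R),
    (0 < M)%nat -> (0 < N)%nat -> Nat.Even M ->
    hyperbolic_parameters N alpha gamma delta ->
    QC_system M N y -> boundary_conditions M N y ->
    (* the denominators occurring in the two sums below do not vanish *)
    (forall k : nat, (1 <= k <= 2 * N - 1)%nat -> Nat.Odd k ->
       PrRp M (rho M (alpha k)) (gamma k) (delta k) <> 0) /\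
    (forall m n : Z,
       (- Z.of_nat M <= m <= -1)%Z -> (- Z.of_nat N <= n <= Z.of_nat N)%Z ->
       y m n =
         - (2 * bond_length M / INR N) *
         odd_sum N (fun k =>
           calQ M (gamma k) (delta k)
             / PrRp M (rho M (alpha k)) (gamma k) (delta k)
           * (sinh (IZR (Z.of_nat M + m) * alpha k) / sinh (INR (M - 1) * alpha k))
           * rho M (alpha k)
           * cot (INR k * PI / (4 * INR N))
           * sin (INR k * PI / (2 * INR N) * IZR (n + Z.of_nat N)))) /\
    (forall m n : Z,
       (0 <= m <= Z.of_nat M)%Z -> (- Z.of_nat N <= n <= Z.of_nat N)%Z ->
       y m n =
         - (2 * bond_length M / INR N) *
         odd_sum N (fun k =>
           calQm M m (rho M (alpha k)) (gamma k) (delta k)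
             / PrRp M (rho M (alpha k)) (gamma k) (delta k)
           * cot (INR k * PI / (4 * INR N))
           * sin (INR k * PI / (2 * INR N) * IZR (n + Z.of_nat N)))) /\
    (forall k : nat, (1 <= k <= 2 * N - 1)%nat ->
       let r := rho M (alpha k) in
       let F j := F_ M j (gamma k) (delta k) in
       let f j := f_ M j (gamma k) (delta k) in
       PrRp M r (gamma k) (delta k) =
         6 * (8 * r - 1) * det2 (F 0%Z) (- F (-1)%Z)
                                (f 0%Z) (f (-1)%Z)
         + (25 * r - 3) * det2 (- F 1%Z) (F 0%Z)
                               (f 1%Z)   (f 0%Z)
         - det2 (- F 1%Z) (F (-2)%Z)
                (f 1%Z)   (f (-2)%Z)
         + (2 - r) * det2 (- F (-1)%Z) (F (-2)%Z)
                          (f (-1)%Z)   (f (-2)%Z)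
         + (5 * r - 1) * det2 (- F 1%Z) (- F (-1)%Z)
                              (f 1%Z)   (f (-1)%Z)
         - 5 * r * det2 (F 0%Z) (F (-2)%Z)
                        (f 0%Z) (f (-2)%Z)).
Proof.
  intros M N alpha gamma delta y HM0 HN Hev Hpar Hy By.
  assert (HM : (2 <= M)%nat) by (destruct Hev; lia).
  assert (HD : forall k, (1 <= k <= 2 * N - 1)%nat ->
            PrRp M (rho M (alpha k)) (gamma k) (delta k) <> 0).
  { intros k Hk. apply (PrRp_neq0 M N k); try assumption.
    now apply hyperbolic_mode_parameters. }
  pose proof (solution_series M N alpha gamma delta y HM0 HN Hev Hpar Hy By) as Hsol.
  split; [|split; [|split]].
  - intros k Hk _. now apply HD.
  - intros m n Hm Hn. rewrite Hsol by lia. f_equal. apply odd_sum_ext; [assumption|].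
    intros k Hk. unfold solution_mode. rewrite mode_neg, atom_mode_calQ by (auto; lia).
    unfold sine_mode. ring.
  - intros m n Hm Hn. rewrite Hsol by lia. f_equal. apply odd_sum_ext; [assumption|].
    intros k Hk. unfold solution_mode. rewrite mode_nonneg, atom_mode_calQm by (auto; lia).
    unfold sine_mode. ring.
  - intros k Hk. cbv zeta. unfold PrRp, P_, p_, R_, r_, det2. ring.
Qed.
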